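(* As formal power series, $\sum_{k\ge 0}|\mathcal{U}_{2k+1}(231,4312)|\,x^k = C(xC(x))$, where $C(x)=\frac{1-\sqrt{1-4x}}{2x}=\sum_{k\ge0}\frac{1}{k+1}\binom{2k}{k}x^k$ is the generating function of the Catalan numbers.
   Context: West's stack-sorting map $s$ is defined recursively on finite sequences of distinct positive integers: $s$ sends the empty sequence to itself, and if $\pi$ is a nonempty such sequence with largest entry $n$, writing $\pi=LnR$ one sets $s(\pi)=s(L)s(R)n$. A permutation $\pi\in S_n$ (one-line notation) is uniquely sorted if exactly one permutation $\sigma\in S_n$ satisfies $s(\sigma)=\pi$. Let $\mathcal{U}_n$ be the set of uniquely sorted permutations in $S_n$. A permutation $\pi$ contains a pattern $\tau\in S_m$ if some subsequence of $\pi$ of length $m$ has its entries in the same relative order as $\tau$; otherwise $\pi$ avoids $\tau$. $\mathcal{U}_{n}(\tau^{(1)},\dots,\tau^{(\ell)})$ denotes the set of permutations in $\mathcal{U}_n$ avoiding all of $\tau^{(1)},\dots,\tau^{(\ell)}$. *)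

(* Defs.v *)
From mathcomp Require Import all_boot all_order all_fingroup all_algebra.
From mathcomp Require Import ring zify.

Set Implicit Arguments.
Unset Strict Implicit.
Unset Printing Implicit Defensive.

Import GRing.Theory.

(* The recursion s(LnR) = s(L)s(R)n is not structural, so it is run with fuel;
   [stack_sort_max] is the defining equation. *)
Fixpoint stack_sort_rec (fuel : nat) (w : seq nat) : seq nat :=
  if fuel is fuel'.+1 then
    if w is [::] then [::] else
    let n := \max_(x <- w) x in
    let i := index n w in
    stack_sort_rec fuel' (take i w) ++ stack_sort_rec fuel' (drop i.+1 w) ++ [:: n]
  else [::].

Definition stack_sort (w : seq nat) : seq nat := stack_sort_rec (size w) w.

Lemma stack_sort_nil : stack_sort [::] = [::].
Proof. by []. Qed.

Lemma stack_sort_rec_max k L n R :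
    all (fun x => x < n) L -> all (fun x => x < n) R ->
  stack_sort_rec k.+1 (L ++ n :: R) =
    stack_sort_rec k L ++ stack_sort_rec k R ++ [:: n].
Proof.
move=> ltL ltR.
have maxE : \max_(x <- L ++ n :: R) x = n.
  apply/eqP; rewrite eqn_leq; apply/andP; split.
    apply/bigmax_leqP_seq => x; rewrite mem_cat inE => + _.
    case/or3P => [xL|/eqP-> //|xR]; apply: ltnW.
      exact: (allP ltL).
    exact: (allP ltR).
  by rewrite big_cat big_cons /= leq_max leq_maxl orbT.
have nL : n \notin L by apply/negP => /(allP ltL); rewrite ltnn.
have idxE : index n (L ++ n :: R) = size L.
  by rewrite index_cat (negbTE nL) /= eqxx addn0.
have -> : stack_sort_rec k.+1 (L ++ n :: R) =
    let m := \max_(x <- L ++ n :: R) x in let i := index m (L ++ n :: R) in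
    stack_sort_rec k (take i (L ++ n :: R)) ++
    stack_sort_rec k (drop i.+1 (L ++ n :: R)) ++ [:: m].
  by case: L {ltL maxE nL idxE}.
rewrite /= maxE idxE take_size_cat // -addn1 addnC -drop_drop.
by rewrite drop_size_cat //= drop0.
Qed.

Lemma stack_sort_rec_fuel k w :
  size w <= k -> stack_sort_rec k w = stack_sort w.
Proof.
rewrite /stack_sort.
suff H l : forall j w, size w <= j -> size w <= l ->
    stack_sort_rec j w = stack_sort_rec l w by move=> wk; apply: H.
elim: l => [|l IHl] [|j] [|a v] //= sj sl.
set n := \max_(x <- a :: v) x; set i := if a == n then _ else _.
have sT : size (take i (a :: v)) <= size v.
  have : n \in a :: v.
    rewrite /n; elim: (v) a {n i} => [|b u IHu] a; first by rewrite big_seq1 inE.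
    rewrite big_cons inE; case: leqP => _; first by rewrite IHu orbT.
    by rewrite eqxx.
  rewrite -index_mem => ltI; have {}ltI : i < (size v).+1 := ltI.
  by rewrite size_take /= ltI -ltnS.
have sD : size (drop i v) <= size v by rewrite size_drop leq_subr.
by congr (_ ++ (_ ++ _)); apply: IHl; apply: leq_trans; eassumption.
Qed.

Lemma stack_sort_max L n R :
    all (fun x => x < n) L -> all (fun x => x < n) R ->
  stack_sort (L ++ n :: R) = stack_sort L ++ stack_sort R ++ [:: n].
Proof.
move=> ltL ltR; rewrite {1}/stack_sort size_cat /= addnS stack_sort_rec_max //.
by rewrite !stack_sort_rec_fuel ?leq_addl ?leq_addr.
Qed.

(* Entries are 1, ..., n although ['I_n] starts at 0. *)
Definition one_line (n : nat) (p : 'S_n) : seq nat :=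
  [seq (val (p i)).+1 | i : 'I_n].

Definition uniquely_sorted (n : nat) (p : 'S_n) : bool :=
  #|[set q : 'S_n | stack_sort (one_line q) == one_line p]| == 1.

Definition same_order (u v : seq nat) : bool :=
  (size u == size v) &&
  [forall i : 'I_(size u), forall j : 'I_(size u),
     (nth 0 u i < nth 0 u j) == (nth 0 v i < nth 0 v j)].

(* Patterns are given in one-line notation, e.g. [:: 2; 3; 1] for 231. *)
Definition contains (w tau : seq nat) : bool :=
  [exists m : (size w).-tuple bool, same_order (mask m w) tau].

Lemma containsP (w tau : seq nat) :
  reflect (exists2 u, subseq u w & same_order u tau) (contains w tau).
Proof.
apply: (iffP existsP) => [[m mo]|[u /subseqP[m sm ->] mo]].
  by exists (mask m w) => //; apply: mask_subseq.
by exists (tcast sm (in_tuple m)); rewrite val_tcast.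
Qed.

Definition avoids (w tau : seq nat) : bool := ~~ contains w tau.

Definition uniquely_sorted_avoiding (n : nat) (taus : seq (seq nat)) :
    {set 'S_n} :=
  [set p : 'S_n | uniquely_sorted p && all (avoids (one_line p)) taus].

Local Open Scope ring_scope.

(* A formal power series is its sequence of coefficients; equality of series
   is pointwise equality [=1]. *)
Definition fps : Type := nat -> rat.

Definition fps_one : fps := fun n => (n == 0)%:R.

Definition fps_X : fps := fun n => (n == 1)%:R.

Definition fps_mul (f g : fps) : fps :=
  fun n => \sum_(i < n.+1) f i * g (n - i)%N.

Definition fps_exp (f : fps) (k : nat) : fps := iter k (fps_mul f) fps_one.

(* f(g(x)), meaningful when g has zero constant term: the coefficient of x^n
   in g^k then vanishes for k > n, so the sum over all k stops at k = n. *)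
Definition fps_comp (f g : fps) : fps :=
  fun n => \sum_(k < n.+1) f k * fps_exp g k n.

Definition catalan_series : fps := fun k => 'C(2 * k, k)%:R / k.+1%:R.

(* [catalan_series] is (1 - sqrt(1 - 4x)) / (2x): the series 1 - 2x C(x) has
   constant term 1 and squares to 1 - 4x. *)
Definition sqrt_1m4x : fps :=
  fun n => fps_one n - 2 * fps_mul fps_X catalan_series n.

Lemma fps_mulX f n : fps_mul fps_X f n = if n is m.+1 then f m else 0.
Proof.
rewrite /fps_mul /fps_X; case: n => [|m]; first by rewrite big_ord1 mul0r.
rewrite !big_ord_recl /= mul0r add0r mul1r subn1 /= big1 ?addr0 // => i _.
by rewrite mul0r.
Qed.

Lemma sqrt_1m4x0 : sqrt_1m4x 0%N = 1.
Proof. by rewrite /sqrt_1m4x fps_mulX mulr0 subr0. Qed.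

Lemma sqrt_1m4x_rec k :
  k.+1%:R * sqrt_1m4x k.+1 = (4 * k%:R - 2) * sqrt_1m4x k.
Proof.
rewrite /sqrt_1m4x !fps_mulX /fps_one /= /catalan_series.
case: k => [|k] /=; first by rewrite bin0; field.
have nz j : (j.+1%:R : rat) != 0 by rewrite Num.Theory.pnatr_eq0.
have binE : (k.+1 * 'C(2 * k.+1, k.+1) = 2 * (2 * k).+1 * 'C(2 * k, k))%N.
  have -> : (2 * k.+1 = (2 * k).+2)%N by rewrite mulnS.
  have E1 := mul_bin_diag (2 * k).+1 k; rewrite /= in E1.
  have E2 := mul_bin_left (2 * k).+1 k.
  have E3 : ((2 * k).+1 - k = k.+1)%N by lia.
  rewrite E3 in E2.
  by rewrite binS mulnDr -E2 -E1 addnn -[in LHS]mul2n mulnA.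
have /(congr1 (fun m => m%:R : rat)) := binE.
rewrite !natrM => binR.
have -> : ('C(2 * k.+1, k.+1)%:R : rat) =
    2 * (2 * k).+1%:R * 'C(2 * k, k)%:R / k.+1%:R.
  by rewrite -binR mulrC mulKf.
have := nz k; have := nz k.+1.
rewrite -!(natr1, natrM) => n1 n2; field; exact/andP.
Qed.

Lemma sqrt_1m4xP n :
  fps_mul sqrt_1m4x sqrt_1m4x n = fps_one n - 4 * fps_X n.
Proof.
set s := sqrt_1m4x; pose T := fps_mul s s.
have T2 m : m%:R * T m = 2 * \sum_(i < m.+1) i%:R * s i * s (m - i)%N.
  have -> : 2 * \sum_(i < m.+1) i%:R * s i * s (m - i)%N =
     \sum_(i < m.+1) i%:R * s i * s (m - i)%N +
     \sum_(i < m.+1) (m - i)%:R * s i * s (m - i)%N.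
    rewrite mulr_natl mulr2n; congr (_ + _).
    rewrite (reindex_inj rev_ord_inj) /=; apply: eq_bigr => i _.
    by rewrite subSS subKn -1?ltnS // -mulrA [s _ * _]mulrC mulrA.
  rewrite -big_split /T /fps_mul mulr_sumr /=; apply: eq_bigr => i _.
  by rewrite -!mulrDl -natrD subnKC -1?ltnS // mulrA.
have Trec m : m.+1%:R * T m.+1 = 4 * (m%:R - 1) * T m.
  rewrite T2 big_ord_recl !mul0r add0r.
  have -> : \sum_(i < m.+1) (lift ord0 i)%:R * s (lift ord0 i) *
       s (m.+1 - lift ord0 i)%N =
     4 * (\sum_(i < m.+1) i%:R * s i * s (m - i)%N) - 2 * T m.
    rewrite /T /fps_mul !mulr_sumr -sumrB; apply: eq_bigr => i _.
    rewrite lift0 subSS sqrt_1m4x_rec -/s; ring.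
  rewrite mulrBr mulrCA -T2; ring.
have T0 : T 0%N = 1 by rewrite /T /fps_mul big_ord1 /s sqrt_1m4x0 mulr1.
have T1 : T 1%N = - 4 by have := Trec 0%N; rewrite T0 mul1r => ->; ring.
have T2n m : T m.+2 = 0.
  have nz j : (j.+1%:R : rat) != 0 by rewrite Num.Theory.pnatr_eq0.
  elim: m => [|m IHm]; apply: (mulfI (nz _)).
    rewrite mulr0; apply: etrans (Trec 1%N) _.
    by rewrite subrr mulr0 mul0r.
  by rewrite mulr0; apply: etrans (Trec m.+2) _; rewrite IHm mulr0.
rewrite -/(T n) /fps_one /fps_X.
by case: n => [|[|n]]; rewrite ?T0 ?T1 ?T2n /= ?mulr0 ?subr0 ?mulr1 ?sub0r.
Qed.

(* Main.v *)
(* A word ending in its largest letter n is stack-sorted in as many ways as the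
   rest of it splits into two stack-sorted words.  Since a stack-sorted word of
   size m has fewer than m/2 descents, as do its suffixes, this makes the
   uniquely sorted words exactly the "tight" ones: [n], and a ++ b ++ [n] with
   a, b tight and a descent from a to b.  A word is tight when a greedy stack
   machine, in which a descent pushes and an ascent pops, ends with one letter.

   A permutation avoiding 231 and 4312 is built by appending its letters one at
   a time: relative to the previous letters, the new one lies just below the
   last letter (Fall), just below the maximum (Rise), or on top (Peak).  The
   machine then only depends on its height and on the position of the maximum in
   its stack.  With C = 1 + x C^2 counting the runs without Peak, the series G
   of all runs from height 0 to height 0 satisfies G = 1 + x C G^2, which is the
   Catalan equation at x C. *)
From HB Require Import structures.
Require Import Defs.
From mathcomp Require Import all_boot all_order all_fingroup all_algebra.
From mathcomp Require Import qpoly ring lra zify.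

Set Implicit Arguments.
Unset Strict Implicit.
Unset Printing Implicit Defensive.

Import GRing.Theory.

(** * Preimages under the stack-sorting map *)

Lemma max_split (v : seq nat) : v != [::] -> uniq v ->
  exists L n R, [/\ v = L ++ n :: R, all (ltn^~ n) L & all (ltn^~ n) R].
Proof.
move=> v0 uv; pose n := \max_(x <- v) x.
have nv : n \in v.
  rewrite /n; case: v v0 {uv n} => // a v _.
  elim: v a => [|b v IHv] a; first by rewrite big_seq1 inE.
  rewrite big_cons inE; case: leqP => _; first by rewrite IHv orbT.
  by rewrite eqxx.
have le_n x : x \in v -> x <= n by move=> xv; apply: leq_bigmax_seq.
case/splitPr: nv uv le_n => L R; rewrite cat_uniq /= => /and3P[_ LR /andP[nR _]].
move=> le_n; exists L, n, R; split=> //; apply/allP => x xw; rewrite /= ltn_neqAle.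
  rewrite le_n ?mem_cat ?xw // andbT; apply: contra LR => /eqP <-.
  by rewrite xw.
rewrite le_n ?mem_cat ?inE ?xw ?orbT // andbT.
by apply: contraNneq nR => <-.
Qed.

(** The recursion of [stack_sort] as an induction principle: strong induction on the length, cutting
    at the largest letter. *)
Lemma max_ind (P : seq nat -> Prop) : P [::] ->
    (forall L n R, all (ltn^~ n) L -> all (ltn^~ n) R ->
       uniq (L ++ n :: R) -> P L -> P R -> P (L ++ n :: R)) ->
  forall v, uniq v -> P v.
Proof.
move=> P0 PS v; have [m] := ubnP (size v); elim: m v => // m IHm v vm uv.
have [-> //|v0] := eqVneq v [::].
have [L [n [R [Ev ltL ltR]]]] := max_split v0 uv.
move: (vm) (uv); rewrite Ev size_cat /= ltnS => {}vm {}uv; apply: PS => //.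
all: apply: IHm; first by
  apply: leq_trans vm; rewrite ?leq_addr ?addnS ?ltnS ?leq_addr ?leq_addl.
all: by move: uv; rewrite cat_uniq /= => /and3P[? _ /andP[_ ?]].
Qed.

Lemma perm_stack_sort v : uniq v -> perm_eq (stack_sort v) v.
Proof.
move: v; apply: max_ind => // L n R ltL ltR _ pL pR.
rewrite stack_sort_max // (perm_cat pL) //= cats1 perm_rcons perm_cons.
exact: pR.
Qed.

Lemma stack_sort_eq0 v : uniq v -> (stack_sort v == [::]) = (v == [::]).
Proof. by move=> /perm_stack_sort /perm_size sv; rewrite -!size_eq0 sv. Qed.

(** The default [x] of [head] makes the last letter contribute nothing. *)
Fixpoint des (w : seq nat) : nat :=
  if w is x :: w' then (head x w' < x) + des w' else 0.

Lemma des_cat a b x : a != [::] -> b != [::] ->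
  des (a ++ b) = des a + (head x b < last x a) + des b.
Proof.
move=> + b0; elim: a => // y [|z a] IHa _.
  by case: b b0 {IHa} => // z b _; rewrite /= ltnn; lia.
by have := IHa isT; rewrite /= => ->; rewrite !addnA.
Qed.

Definition stack_sorted (w : seq nat) := exists2 v, uniq v & stack_sort v = w.

Lemma stack_sorted_uniq w : stack_sorted w -> uniq w.
Proof. by move=> [v uv <-]; rewrite (perm_uniq (perm_stack_sort uv)). Qed.

Lemma stack_sortedS a b n : uniq (a ++ b) -> all (ltn^~ n) (a ++ b) ->
  (a = [::] \/ stack_sorted a) -> (b = [::] \/ stack_sorted b) ->
  stack_sorted (a ++ b ++ [:: n]).
Proof.
have sE w : (w = [::] \/ stack_sorted w) -> stack_sorted w.
  by case=> // ->; exists [::].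
move=> uab ltab /sE[L uL sL] /sE[R uR sR]; subst a b.
have pL := perm_stack_sort uL; have pR := perm_stack_sort uR.
move: ltab; rewrite all_cat (perm_all _ pL) (perm_all _ pR) => /andP[ltL ltR].
exists (L ++ n :: R); last exact: stack_sort_max.
move: uab; rewrite !cat_uniq (perm_has _ pR) (eq_has (perm_mem pL)) => /and3P[_ + _].
rewrite /= uL uR /= => /negbTE ->; rewrite orbF andbT.
by apply/andP; split; apply/negP; [move/(allP ltL)|move/(allP ltR)]; rewrite /= ltnn.
Qed.

Lemma stack_sorted_inv w : stack_sorted w -> w != [::] ->
  exists a b n, [/\ w = a ++ b ++ [:: n], all (ltn^~ n) (a ++ b),
     stack_sorted a & stack_sorted b].
Proof.
move=> [v uv <-]; rewrite stack_sort_eq0 // => v0.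
have [L [n [R [Ev ltL ltR]]]] := max_split v0 uv.
rewrite Ev stack_sort_max // in uv *.
move: uv; rewrite cat_uniq /= => /and3P[uL _ /andP[_ uR]].
exists (stack_sort L), (stack_sort R), n; split=> //; [|by exists L|by exists R].
rewrite all_cat (perm_all _ (perm_stack_sort uL)) ltL.
by rewrite (perm_all _ (perm_stack_sort uR)).
Qed.

(** Levi's lemma; requiring [e] nonempty in the second case makes the two cases exclusive. *)
Lemma cat_eq_cat (T : Type) (a b c d : seq T) : a ++ b = c ++ d ->
  (exists e, c = a ++ e /\ b = e ++ d) \/
  (exists e, [/\ e <> [::], a = c ++ e & d = e ++ b]).
Proof.
elim: a c => [|x a IHa] [|y c] //=.
- by move=> ->; left; exists [::].
- by move=> ->; left; exists (y :: c).
- by move=> <-; right; exists (x :: a).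
case=> -> /IHa[[e [-> ->]]|[e [e0 -> ->]]]; first by left; exists e.
by right; exists e.
Qed.

(** Induction on the length of the whole word, cut as [L ++ R ++ [:: n]]. The suffix starts in [L],
    starts in [R], or is [[:: n]]; the final [n] adds a letter but no descent, which turns a weak
    bound for the rest into a strict one. *)
Lemma stack_sorted_suffix_des a b :
  stack_sorted (a ++ b) -> b != [::] -> (des b).*2 < size b.
Proof.
move: {2}(size _) (leqnn (size (a ++ b))) => m.
elim: m a b => [|m IHm] a b sab; first by case: b sab => // x b; rewrite size_cat addnS.
move=> /stack_sorted_inv; have [->|b0] := eqVneq b [::]; first by [].
case; first by case: (a).
move=> L [R [n [E ltw sL sR]]] _.
have step c : all (ltn^~ n) c -> b = c ++ [:: n] ->
    (c = [::] \/ (des c).*2 <= size c) -> (des b).*2 < size b.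
  move=> ltc -> [->|dc]; first by rewrite /= ltnn.
  have [->|c0] := eqVneq c [::]; first by rewrite /= ltnn.
  rewrite (@des_cat _ _ 0) //= size_cat /= ltnn.
  suff -> : n < last 0 c = false by lia.
  case: c c0 ltc {dc} => // x c _ ltc.
  by have := allP ltc (last x c) (mem_last _ _); rewrite /=; lia.
have sLR : size (L ++ R) <= m.
  by move: sab; rewrite E !size_cat /=; lia.
move: ltw; rewrite all_cat => /andP[ltL ltR].
have sR2 e f : R = e ++ f -> (des f).*2 <= size f.
  move=> ER; have [->//|f0] := eqVneq f [::].
  by apply/ltnW/(IHm e f) => //; rewrite -?ER //; move: sLR; rewrite size_cat; lia.
have sL2 e f : L = e ++ f -> f != [::] -> (des f).*2 < size f.
  by move=> EL; apply: (IHm e f); rewrite -?EL //; move: sLR; rewrite size_cat; lia.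
case: (cat_eq_cat E) => [[e [EL Eb]]|[e [e0 _ Eb]]].
  apply: (step (e ++ R)); rewrite -?catA //.
    by rewrite all_cat ltR andbT; move: ltL; rewrite EL all_cat => /andP[].
  have [->|en] := eqVneq e [::]; first by right; apply: (sR2 [::]).
  right; have [->|Rn] := eqVneq R [::]; first by rewrite cats0 ltnW // (sL2 a).
  (* The strict bounds for [e] and [R] leave one letter to spare each, which pays for a possible
     descent between them. *)
  rewrite (@des_cat _ _ 0) // size_cat.
  have lte := sL2 _ _ EL en.
  have ltR' : (des R).*2 < size R.
    by apply: (IHm [::]) => //=; move: sLR; rewrite size_cat; lia.
  by case: (_ < _); lia.
case: (cat_eq_cat Eb) => [[f [Ee Ebf]]|[f [f0 ER Ebf]]].
  move: Ebf b0; case: f Ee => [|x f] _; first by move=> /= <-; rewrite /= ltnn.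
  by case: b {E Eb step sab} => // y [|z b]; [rewrite /= ltnn|case: f].
apply: (step f) => //; last by right; apply: (sR2 e).
by move: ltR; rewrite ER all_cat => /andP[].
Qed.

(** * Tight words and uniqueness of preimages *)

Inductive tight : seq nat -> Prop :=
| Tight1 n : tight [:: n]
| TightS a b n : tight a -> tight b -> head n b < last n a ->
    all (ltn^~ n) (a ++ b) -> tight (a ++ b ++ [:: n]).

Lemma tight_neq0 w : tight w -> w != [::].
Proof. by case=> // a b n _ _ _ _; case: a => //; case: b. Qed.

(** Tight words are extremal for [stack_sorted_suffix_des]: joining [a] and [b] creates one new
    descent, and [n] restores the odd length. *)
Lemma tight_des w : tight w -> (des w).*2.+1 = size w.
Proof.
elim=> [n|a b n ta IHa tb IHb lt_ba ltab]; first by rewrite /= ltnn.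
have [a0 b0] := (tight_neq0 ta, tight_neq0 tb).
have bn0 : b ++ [:: n] != [::] by case: (b).
have lt_bn : last n b < n.
  case: b b0 ltab {ta tb IHa IHb lt_ba bn0} => // x b _; rewrite all_cat.
  by move=> /andP[_ /allP]; apply; apply: mem_last.
rewrite (@des_cat _ _ n) // (@des_cat b _ n) //= ltnn.
have -> : head n (b ++ [:: n]) = head n b by case: (b) b0.
rewrite lt_ba; have -> : n < last n b = false by lia.
by rewrite !size_cat /= -IHa -IHb; lia.
Qed.

Lemma tight_stack_sorted w : uniq w -> tight w -> stack_sorted w.
Proof.
move=> + tw; elim: tw => [n _|a b n _ IHa _ IHb _ ltab]; first
  exact: (@stack_sortedS [::] [::] n isT isT (or_introl erefl) (or_introl erefl)).
rewrite {1}catA cat_uniq => /andP[uab _]; apply: stack_sortedS => //; right.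
  by apply: IHa; move: uab; rewrite cat_uniq => /andP[].
by apply: IHb; move: uab; rewrite cat_uniq => /and3P[].
Qed.

Lemma last_cat_cons (a b : seq nat) x : b != [::] -> last x (a ++ b) = last x b.
Proof. by case: b => // y b; rewrite last_cat. Qed.

(* Every other way of cutting [a ++ b] into two stack-sorted words would force
   more descents in some suffix than [stack_sorted_suffix_des] allows. *)
Lemma tight_split_unique a b c d : stack_sorted a -> stack_sorted b ->
    tight a -> tight b ->
    (forall x, head x b < last x a) -> stack_sorted c -> stack_sorted d ->
  a ++ b = c ++ d -> a = c /\ b = d.
Proof.
move=> sa sb ta tb lt_ba sc sd E.
have [a0 b0] := (tight_neq0 ta, tight_neq0 tb).
have [da db] := (tight_des ta, tight_des tb).
(* This exceeds the bound for stack-sorted words, so [a ++ b] is not stack-sorted; hence neither [c]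
   nor [d] can be empty. *)
have dab : (des (a ++ b)).*2 = size (a ++ b).
  by rewrite (@des_cat _ _ 0) // lt_ba size_cat; lia.
have c0 : c != [::].
  apply: contra_eq_neq dab => c0; move: sd; rewrite -[d]/([::] ++ d) -c0 -E.
  rewrite -[a ++ b]/([::] ++ (a ++ b)) => /stack_sorted_suffix_des.
  by case: (a) a0 => // x a' _ /(_ isT); rewrite /=; lia.
have d0 : d != [::].
  apply: contra_eq_neq dab => d0; move: sc; rewrite -[c]cats0 -d0 -E.
  rewrite -[a ++ b]/([::] ++ (a ++ b)) => /stack_sorted_suffix_des.
  by case: (a) a0 => // x a' _ /(_ isT); rewrite /=; lia.
have dc : (des c).*2 < size c by apply: (@stack_sorted_suffix_des [::]).
have dd : (des d).*2 < size d by apply: (@stack_sorted_suffix_des [::]).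
(* The suffix bound, applied to the last letter of [e] followed by [f]. *)
have dcons e f g : stack_sorted (g ++ e ++ f) -> e != [::] -> f != [::] ->
    (des f).*2 + (head 0 f < last 0 e).*2 <= size f.
  move=> + e0 f0; case/lastP: e e0 => // e x _.
  rewrite -cats1 -catA catA => /stack_sorted_suffix_des /(_ isT).
  rewrite last_cat /=.
  by have -> : head x f = head 0 f; [case: (f) f0|lia].
have [[e [Ec Eb]]|[e [e0 Ea Ed]]] := cat_eq_cat E.
  have [e0|e0] := eqVneq e [::]; first by rewrite Ec Eb e0 cats0.
  (* Here [c = a ++ e] contains the descent from [a] to [b], so its bound leaves
     [2 des e + 2 <= size e]; then [b = e ++ d] has too few descents to be tight. *)
  exfalso; rewrite Ec (@des_cat _ _ 0) // size_cat in dc.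
  rewrite Eb in sb; have := dcons e d [::] sb e0 d0.
  have he : head 0 e = head 0 b by rewrite Eb; case: (e) e0.
  rewrite he lt_ba in dc.
  rewrite Eb (@des_cat _ _ 0) // size_cat in db.
  by move: (_ < _) db; case; lia.
(* Here [d = e ++ b] contains the last letter of [a] followed by [b], and the descent between them
   violates the suffix bound. *)
exfalso; have {}e0 : e != [::] by apply/eqP.
rewrite Ed in sd; have := dcons e b [::] sd e0 b0.
have -> : last 0 e = last 0 a by rewrite Ea last_cat_cons.
by rewrite lt_ba; lia.
Qed.

(** A preimage of [a ++ b ++ [:: n]] is [L ++ n :: R], and [tight_split_unique] forces the images of
    [L] and [R] to be [a] and [b]; induction then determines [L] and [R]. *)
Lemma stack_sort_tight_inj w v v' : tight w -> uniq v -> uniq v' ->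
  stack_sort v = w -> stack_sort v' = w -> v = v'.
Proof.
move=> tw; elim: tw v v' => [n|a b n ta IHa tb IHb lt_ba ltab] v v' uv uv' sv sv'.
  have [pv pv'] := (perm_stack_sort uv, perm_stack_sort uv').
  rewrite sv in pv; rewrite sv' in pv'.
  have p1 s : perm_eq [:: n] s -> s = [:: n].
    by rewrite perm_sym; apply: perm_small_eq.
  by rewrite (p1 _ pv) (p1 _ pv').
have uw : uniq (a ++ b ++ [:: n]).
  by apply: stack_sorted_uniq; exists v.
have [ua ub] : uniq a /\ uniq b.
  by move: uw; rewrite !cat_uniq => /and3P[-> _ /and3P[->]].
have sa := tight_stack_sorted ua ta; have sb := tight_stack_sorted ub tb.
have lt_ba' x : head x b < last x a.
  by move: (tight_neq0 ta) (tight_neq0 tb) lt_ba; case: (a); case: (b).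
have inv u : uniq u -> stack_sort u = a ++ b ++ [:: n] -> exists L R,
    [/\ u = L ++ n :: R, uniq L, uniq R, stack_sort L = a & stack_sort R = b].
  move=> uu su; have u0 : u != [::].
    by rewrite -stack_sort_eq0 // su; case: (a) => //; case: (b).
  have [L [m [R [Eu ltL ltR]]]] := max_split u0 uu.
  move: uu; rewrite Eu cat_uniq /= => /and3P[uL _ /andP[_ uR]].
  move: su; rewrite Eu stack_sort_max // !catA !cats1 => /rcons_inj[E <-].
  have [||->->] := tight_split_unique sa sb ta tb lt_ba' _ _ (esym E).
  - by exists L.
  - by exists R.
  by exists L, R.
have [L [R [-> uL uR sL sR]]] := inv v uv sv.
have [L' [R' [-> uL' uR' sL' sR']]] := inv v' uv' sv'.
by rewrite (IHa L L') // (IHb R R').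
Qed.

(** Without a descent between the two images, a single word sorts to their concatenation. With [b]
    the maximum of [R] and [R = R1 ++ b :: R2], all of [L] lies below [b], so [L] can be merged into
    [R1], recursively, to the left of [b]. This provides a second preimage in
    [stack_sort_unique_tight]. *)
Lemma stack_sort_ascent L R : uniq (L ++ R) -> L != [::] -> R != [::] ->
    (forall x, last x (stack_sort L) < head x (stack_sort R)) ->
    all (leq^~ (last 0 (stack_sort L))) L ->
  exists2 v, perm_eq v (L ++ R) & stack_sort v = stack_sort L ++ stack_sort R.
Proof.
move: {2}(size R) (leqnn (size R)) => k; elim: k R => [|k IHk] R.
  by case: R.
move=> sR uLR L0 R0 lt_LR leL; have uR : uniq R.
  by move: uLR; rewrite cat_uniq => /and3P[].
have [R1 [b [R2 [ER ltR1 ltR2]]]] := max_split R0 uR.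
rewrite ER in uLR uR sR lt_LR *; rewrite stack_sort_max // in lt_LR *.
move: uR; rewrite cat_uniq /= => /and3P[uR1 _ /andP[_ uR2]].
have ltL : all (ltn^~ b) L.
  apply/allP=> x /(allP leL) /= /leq_ltn_trans; apply.
  apply: leq_trans (lt_LR 0) _; set s := _ ++ _.
  have : head 0 s \in s.
    rewrite /s; case: (stack_sort R1) => [|y t]; last exact: mem_head.
    by case: (stack_sort R2) => [|y t]; apply: mem_head.
  rewrite {2}/s !mem_cat (perm_mem (perm_stack_sort uR1)) inE.
  rewrite (perm_mem (perm_stack_sort uR2)).
  by case/or3P => [/(allP ltR1)|/(allP ltR2)|/eqP->] // /ltnW.
have [R10|R10] := eqVneq R1 [::].
  exists (L ++ b :: R2); first by rewrite R10.
  by rewrite stack_sort_max // R10.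
have [|||v pv sv] := IHk R1 _ _ L0 R10 _ leL.
- by move: sR; rewrite size_cat /=; lia.
- by move: uLR; rewrite catA cat_uniq => /andP[].
- move=> x; have := lt_LR x; rewrite -(stack_sort_eq0 uR1) in R10.
  by case: (stack_sort R1) R10.
exists (v ++ b :: R2); first by rewrite catA (perm_cat pv).
rewrite stack_sort_max ?sv ?catA // (perm_all _ pv) all_cat ltL.
exact: ltR1.
Qed.

(** Write [v = L ++ n :: R]. If exactly one side is empty, moving [n] to the other end gives a
    second preimage. Otherwise both sides inherit uniqueness, hence are tight by induction, and
    [stack_sort_ascent] rules out an ascent between their images. *)
Lemma stack_sort_unique_tight v : uniq v -> v != [::] ->
    (forall u, perm_eq u v -> stack_sort u = stack_sort v -> u = v) ->
  tight (stack_sort v).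
Proof.
move: v; apply: max_ind => // L n R ltL ltR uv IHL IHR _ inj.
move: (uv); rewrite cat_uniq /= => /and3P[uL _ /andP[nR uR]].
have nL : n \notin L by apply/negP => /(allP ltL); rewrite /= ltnn.
(* Such a [u] followed by [n] is also a preimage, so by uniqueness [n] is the last letter of
   [L ++ n :: R]. *)
have last_n u : uniq (u ++ [:: n]) -> all (ltn^~ n) u -> perm_eq u (L ++ R) ->
    stack_sort u = stack_sort L ++ stack_sort R -> R = [::].
  move=> uu ltu pu su; have := inj (u ++ [:: n]).
  rewrite !stack_sort_max // su /= -catA => Einj.
  have {Einj} : u ++ [:: n] = L ++ n :: R.
    apply: Einj => //; rewrite cats1 perm_rcons perm_sym -cat1s perm_catCA.
    by rewrite cat1s perm_cons perm_sym.
  have [//|R0] := eqVneq R [::].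
  move=> /(congr1 (last 0)); rewrite !last_cat /=.
  by case: R R0 nR {pu su ltR uv IHR inj uR} => // y R _ + E; rewrite E /= mem_last.
have pLR u : perm_eq u (L ++ R) -> uniq (u ++ [:: n]) /\ all (ltn^~ n) u.
  move=> pu; rewrite (perm_all _ pu) all_cat ltL ltR cats1 rcons_uniq.
  rewrite (perm_mem pu) (perm_uniq pu) mem_cat negb_or nL nR; split=> //.
  by move: uv; rewrite -cat1s uniq_catCA /= => /andP[].
have right_nil u : perm_eq u (L ++ R) ->
    stack_sort u = stack_sort L ++ stack_sort R -> R = [::].
  by move=> pu; have [uu ltu] := pLR u pu; apply: last_n.
rewrite stack_sort_max //.
have [L0|L0] := eqVneq L [::].
  by rewrite L0 (right_nil R) ?L0 //; apply: Tight1.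
have [R0|R0] := eqVneq R [::].
  exfalso; have := inj (n :: L); rewrite R0 cats1 perm_sym perm_rcons perm_refl.
  rewrite -[n :: L]/([::] ++ n :: L) !(stack_sort_max, cats0) //.
  rewrite -cats1 stack_sort_max //= => /(_ isT erefl).
  case: L L0 nL {ltL uL IHL last_n pLR right_nil uv inj} => // y L _ nL [ny _].
  by rewrite ny mem_head in nL.
have tL : tight (stack_sort L).
  apply: IHL => // u pu su; apply/eqP; have := inj (u ++ n :: R).
  rewrite !stack_sort_max ?(perm_all _ pu) // su perm_cat2r pu.
  by move=> /(_ isT erefl) /eqP; rewrite eqseq_cat ?(perm_size pu) // => /andP[].
have tR : tight (stack_sort R).
  apply: IHR => // u pu su; apply/eqP; have := inj (L ++ n :: u).
  rewrite !stack_sort_max ?(perm_all _ pu) // su perm_cat2l perm_cons pu.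
  by move=> /(_ isT erefl) /eqP; rewrite eqseq_cat // eqxx => /eqP[->].
have uLR : uniq (L ++ R).
  by have [+ _] := pLR _ (perm_refl _); rewrite cat_uniq => /andP[].
have maxL : all (leq^~ (last 0 (stack_sort L))) L.
  have [a [m [b [EL ltab ltb]]]] := max_split L0 uL.
  rewrite EL stack_sort_max // !last_cat /=.
  rewrite all_cat /= leqnn; apply/andP; split.
    by apply: sub_all ltab => x /ltnW.
  by apply: sub_all ltb => x /ltnW.
apply: TightS => //; last first.
  by rewrite all_cat !(perm_all _ (perm_stack_sort _)) // ltL.
have [nL0 nR0] := (tight_neq0 tL, tight_neq0 tR).
rewrite ltnNge; apply/negP => leLR.
have [|v pv sv] := stack_sort_ascent uLR L0 R0 _ maxL.
  move=> x; rewrite ltn_neqAle.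
  have -> : last x (stack_sort L) = last n (stack_sort L) by case: (stack_sort L) nL0.
  have -> : head x (stack_sort R) = head n (stack_sort R) by case: (stack_sort R) nR0.
  rewrite leLR andbT; apply/negP => /eqP E.
  move: uLR; rewrite cat_uniq => /and3P[_ /hasP[]].
  exists (head n (stack_sort R)).
    rewrite -(perm_mem (perm_stack_sort uR)).
    by case: (stack_sort R) nR0 => // y s _; rewrite inE eqxx.
  rewrite -E /= -(perm_mem (perm_stack_sort uL)).
  by case: (stack_sort L) nL0 => // y s _; apply: mem_last.
by move: R0; rewrite (right_nil _ pv sv).
Qed.

(** * Words and permutations *)

Lemma perm_one_line n (p : 'S_n) : perm_eq (one_line p) (iota 1 n).
Proof.
have uq : uniq (one_line p).
  by rewrite map_inj_uniq ?enum_uniq // => i j [/val_inj/perm_inj].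
apply: uniq_perm; rewrite ?iota_uniq // => x; rewrite mem_iota add1n ltnS.
apply/mapP/idP => [[i _ ->]|]; first by rewrite ltn_ord.
case: x => // x ltxn; exists ((p^-1)%g (Ordinal ltxn)); first by rewrite mem_enum.
by rewrite permKV.
Qed.

Lemma one_line_inj n : injective (@one_line n).
Proof.
move=> p q E; apply/permP => i; apply: val_inj; apply: succn_inj.
by move: E => /eq_in_map; apply; rewrite mem_enum.
Qed.

Lemma one_line_onto n w : perm_eq w (iota 1 n) -> exists q : 'S_n, one_line q = w.
Proof.
move=> pw; have sw : size w = n by rewrite (perm_size pw) size_iota.
have uw : uniq w by rewrite (perm_uniq pw) iota_uniq.
have wn (i : 'I_n) : (nth 0 w i).-1 < n.
  have : nth 0 w i \in w by rewrite mem_nth ?sw.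
  by rewrite (perm_mem pw) mem_iota; case: (nth 0 w i); have := ltn_ord i; lia.
have w_gt0 (i : 'I_n) : 0 < nth 0 w i.
  have : nth 0 w i \in w by rewrite mem_nth ?sw.
  by rewrite (perm_mem pw) mem_iota => /andP[].
have inj : injective (fun i => Ordinal (wn i)).
  move=> i j /(congr1 val) /= E; apply: val_inj => /=; apply/eqP.
  by rewrite -(nth_uniq 0 _ _ uw) ?sw // -(prednK (w_gt0 i)) E prednK.
exists (perm inj); apply: (@eq_from_nth _ 0).
  by rewrite size_map size_enum_ord sw.
move=> i; rewrite size_map size_enum_ord => ltin.
rewrite (nth_map (Ordinal ltin)) ?size_enum_ord // permE /= nth_enum_ord //.
by rewrite prednK // -[i]/(val (Ordinal ltin)) w_gt0.
Qed.

(** The empty permutation is uniquely sorted but its word is not tight, whence [0 < n]. *)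
Lemma uniquely_sortedP n (p : 'S_n) :
  0 < n -> reflect (tight (one_line p)) (uniquely_sorted p).
Proof.
move=> n_gt0; have uq (q : 'S_n) : uniq (one_line q).
  by rewrite (perm_uniq (perm_one_line q)) iota_uniq.
apply: (iffP cards1P) => [[q Eq]|tp].
  have : q \in [set q] by rewrite inE.
  rewrite -Eq inE => /eqP sq; rewrite -sq.
  apply: stack_sort_unique_tight => // [|u pu su].
    by rewrite -size_eq0 (perm_size (perm_one_line q)) size_iota -lt0n.
  have [q' Eq'] := one_line_onto (perm_trans pu (perm_one_line q)).
  suff : q' \in [set q] by rewrite inE -Eq' => /eqP->.
  by rewrite -Eq inE Eq' su sq.
have [v uv sv] := tight_stack_sorted (uq p) tp.
have [|q Eq] := @one_line_onto n v.
  rewrite perm_sym -(permPl (perm_one_line p)) -sv perm_stack_sort //.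
exists q; apply/setP => q'; rewrite !inE; apply/eqP/eqP => [sq'|->].
  by apply/one_line_inj/(stack_sort_tight_inj tp) => //; rewrite Eq.
by rewrite Eq.
Qed.

(* Scanning left to right, the word read so far is a concatenation of tight
   words, each starting below the last letter of the previous one; the stack
   holds these last letters, most recent first. *)
Definition parse_step (S : seq nat) (x : nat) : option (seq nat) :=
  if S is l :: S1 then
    if x < l then Some (x :: S) else
    if S1 is p :: S2 then if p < x then Some (x :: S2) else None else None
  else Some [:: x].

Fixpoint parse (S w : seq nat) : option (seq nat) :=
  if w is x :: w' then obind (parse^~ w') (parse_step S x) else Some S.

Lemma parse_cat S a b : parse S (a ++ b) = obind (parse^~ b) (parse S a).
Proof. by elim: a S => //= x a IHa S; case: parse_step. Qed.

Lemma parse_rcons S w x :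
  parse S (rcons w x) = obind (parse_step^~ x) (parse S w).
Proof.
rewrite -cats1 parse_cat; case: (parse S w) => //= T.
by case: parse_step.
Qed.

Lemma parse_map f S w : (forall x y, (f x < f y) = (x < y)) ->
  parse (map f S) (map f w) = omap (map f) (parse S w).
Proof.
move=> mf; elim: w S => //= x w IHw S.
have -> : parse_step (map f S) (f x) = omap (map f) (parse_step S x).
  case: S => //= l S1; rewrite mf; case: ifP => // _.
  by case: S1 => //= p S2; rewrite mf; case: ifP.
by case: parse_step => //= T; rewrite IHw.
Qed.

Lemma last_mem (x : nat) s : s != [::] -> last x s \in s.
Proof. by case: s => // y s _; apply: mem_last. Qed.

(** Reading [a] and then [b] pushes their last letters, thanks to the descent between them; [n]
    exceeds both and replaces them. *)
Lemma tight_parse w S : tight w -> (S = [::] \/ head 0 w < head 0 S) ->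
  parse S w = Some (last 0 w :: S).
Proof.
move=> tw; elim: tw S => [n|a b n ta IHa tb IHb lt_ba ltab] S /=.
  by case: S => [|l S] //= [//|->].
have [a0 b0] := (tight_neq0 ta, tight_neq0 tb).
have -> : head 0 (a ++ b ++ [:: n]) = head 0 a by case: (a) a0.
move=> hS; rewrite !parse_cat IHa //= parse_cat IHb /=; last first.
  by right; move: lt_ba; case: (a) a0; case: (b) b0.
have lt_n : (last 0 a < n) && (last 0 b < n).
  move: ltab; rewrite all_cat => /andP[/allP lta /allP ltb].
  by apply/andP; split; [apply: lta|apply: ltb]; apply: last_mem.
case/andP: lt_n => lta ltb; rewrite ltnNge ltnW //= lta.
by rewrite !last_cat.
Qed.

Inductive stacked : seq nat -> seq nat -> Prop :=
| Stacked0 : stacked [::] [::]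
| StackedS w S g : stacked w S -> tight g ->
    (S = [::] \/ head 0 g < head 0 S) -> stacked (w ++ g) (last 0 g :: S).

Lemma tight_last_max g x : tight g -> x \in g -> x <= last 0 g.
Proof.
case=> [n|a b n _ _ _ /allP ltn_]; first by rewrite inE => /eqP->.
rewrite !last_cat /= catA mem_cat inE => /orP[/ltn_/ltnW //|/eqP-> //].
Qed.

(** A descent opens a new block [[:: x]]; an ascent merges the two top blocks into the tight word
    [g2 ++ g1 ++ [:: x]], since a tight word ends in its maximum. *)
Lemma parse_stacked w S : uniq w -> parse [::] w = Some S -> stacked w S.
Proof.
elim/last_ind: w S => [|w x IHw] S; first by move=> _ [<-]; apply: Stacked0.
rewrite rcons_uniq parse_rcons => /andP[xw uw].
case: (parse _ w) IHw => //= T /(_ T uw erefl) sT.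
have t1 := Tight1 x.
rewrite -cats1; case: sT xw {uw} => [_|w1 T1 g1 sT1 tg1 hg1] /=.
  by move=> [<-]; apply: StackedS Stacked0 t1 _; left.
rewrite mem_cat negb_or => /andP[_ xg1].
case: ifP => [xl [<-]|/negbT xl].
  by apply: (StackedS (StackedS sT1 tg1 hg1) t1); right.
case: sT1 hg1 => // w2 T2 g2 sT2 tg2 hg2 [//|/= hg1].
case: ifP => // ltx [<-]; rewrite -!catA.
have [g10 g20] := (tight_neq0 tg1, tight_neq0 tg2).
have lg1 := last_mem 0 g10.
have -> : x = last 0 (g2 ++ g1 ++ [:: x]) by rewrite !last_cat.
rewrite [in X in stacked X]last_cat !last_cat /=.
have := @StackedS w2 T2 (g2 ++ g1 ++ [:: x]) sT2; rewrite !last_cat; apply.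
  apply: TightS => //.
    by move: hg1; case: (g1) g10; case: (g2) g20.
  have ltg1 : last 0 g1 < x.
    by rewrite ltn_neqAle leqNgt xl andbT; apply: contraNneq xg1 => <-.
  rewrite all_cat; apply/andP; split; apply/allP => y /tight_last_max.
    by move=> /(_ tg2) /leq_ltn_trans; apply.
  by move=> /(_ tg1) /leq_ltn_trans; apply.
by case: (g2) g20 hg2.
Qed.

Lemma tightP w : uniq w ->
  tight w <-> exists2 S, parse [::] w = Some S & size S = 1.
Proof.
move=> uw; split=> [tw|[S /(parse_stacked uw) sw S1]].
  by exists [:: last 0 w] => //; apply: tight_parse => //; left.
by case: sw S1 => // w1 T g sT tg _; case: sT.
Qed.

(** One-line notations of permutations, as a condition on plain words so that the length can vary in
    inductions. *)
Definition std (w : seq nat) :=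
  uniq w && all (fun x => 0 < x <= size w) w.

Lemma std_perm w : std w = perm_eq w (iota 1 (size w)).
Proof.
apply/andP/idP => [[uw /allP wn]|pw].
  have sub : {subset w <= iota 1 (size w)}.
    by move=> x /wn; rewrite mem_iota add1n ltnS.
  have [|_ E] := uniq_min_size uw sub; first by rewrite size_iota.
  by apply: uniq_perm; rewrite ?iota_uniq.
rewrite (perm_uniq pw) iota_uniq; split=> //; apply/allP => x.
by rewrite (perm_mem pw) mem_iota add1n ltnS.
Qed.

Lemma mem_std w x : std w -> (x \in w) = (0 < x <= size w).
Proof. by rewrite std_perm => /perm_mem ->; rewrite mem_iota add1n ltnS. Qed.

(** [bump v] raises the letters that are at least [v] by one, which frees the value [v]. *)
Definition insert_last (v : nat) (w : seq nat) := rcons (map (bump v) w) v.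

Lemma ltn_bump2 v x y : (bump v x < bump v y) = (x < y).
Proof. by rewrite !ltnNge leq_bump2. Qed.

Lemma bump_inj v : injective (bump v).
Proof. exact: can_inj (bumpK v). Qed.

Lemma size_insert_last v w : size (insert_last v w) = (size w).+1.
Proof. by rewrite size_rcons size_map. Qed.

Lemma std_insert_last v w : std w -> 0 < v <= (size w).+1 -> std (insert_last v w).
Proof.
case/andP=> uw /allP wn v_n; apply/andP; split.
  rewrite rcons_uniq (map_inj_uniq (@bump_inj v)) uw andbT.
  by apply/mapP => -[x _ /eqP]; rewrite (negbTE (neq_bump _ _)).
rewrite size_insert_last all_rcons v_n /=; apply/allP => _ /mapP[x /wn + ->].
by rewrite /bump; case: leqP; lia.
Qed.

Lemma std_insert_lastP u : std u -> u != [::] ->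
  exists w v, [/\ std w, 0 < v <= (size w).+1 & u = insert_last v w].
Proof.
case/lastP: u => // u v; rewrite /std size_rcons rcons_uniq all_rcons.
case/andP=> /andP[vu uu] /andP[v_n /allP un] _.
exists (map (unbump v) u), v; rewrite size_map; split=> //.
  apply/andP; split.
    rewrite map_inj_in_uniq // => x y xu yu.
    have xv : x != v by apply: contraNneq vu => <-.
    have yv : y != v by apply: contraNneq vu => <-.
    by move=> /(congr1 (bump v)); rewrite !unbumpK.
  apply/allP => _ /mapP[x xu ->]; have := un x xu.
  have : x != v by apply: contraNneq vu => <-.
  by rewrite /unbump; case: ltnP; lia.
rewrite /insert_last -map_comp; congr rcons.
rewrite -[LHS]map_id; apply/eq_in_map => x xu /=; rewrite unbumpK //.
by rewrite inE; apply: contraNneq vu => <-.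
Qed.

(** * Avoiding 231 and 4312 *)

Definition avoids231 w :=
  forall a b c, subseq [:: a; b; c] w -> ~~ ((c < a) && (a < b)).

Definition avoids4312 w := forall a b c d,
  subseq [:: a; b; c; d] w -> ~~ [&& c < d, d < b & b < a].

Lemma same_order_nth u v i j : same_order u v -> i < size u -> j < size u ->
  (nth 0 u i < nth 0 u j) = (nth 0 v i < nth 0 v j).
Proof.
move=> /andP[_ /forallP H] iu ju.
by have /forallP/(_ (Ordinal ju))/eqP := H (Ordinal iu).
Qed.

Lemma avoids231P w : reflect (avoids231 w) (avoids w [:: 2; 3; 1]).
Proof.
apply: (iffP negP) => [av a b c abc|av /containsP[u uw so]].
  apply/negP => /andP[ca ab]; apply: av; apply/containsP.
  exists [:: a; b; c] => //; apply/andP; split=> //.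
  by apply/forallP => -[[|[|[|//]]] ?]; apply/forallP => -[[|[|[|//]]] ?];
    rewrite /=; lia.
have /andP[/eqP su _] := so; case: u su uw so => [|a [|b [|c [|? ?]]]] // _ uw so.
have /negP := av _ _ _ uw; apply.
by rewrite (same_order_nth (i := 2) (j := 0) so) // (same_order_nth (i := 0) (j := 1) so).
Qed.

Lemma avoids4312P w : reflect (avoids4312 w) (avoids w [:: 4; 3; 1; 2]).
Proof.
apply: (iffP negP) => [av a b c d abcd|av /containsP[u uw so]].
  apply/negP => /and3P[cd db ba]; apply: av; apply/containsP.
  exists [:: a; b; c; d] => //; apply/andP; split=> //.
  by apply/forallP => -[[|[|[|[|//]]]] ?]; apply/forallP => -[[|[|[|[|//]]]] ?];
    rewrite /=; lia.
have /andP[/eqP su _] := so.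
case: u su uw so => [|a [|b [|c [|d [|? ?]]]]] // _ uw so.
have /negP := av _ _ _ _ uw; apply.
rewrite (same_order_nth (i := 2) (j := 3) so) //.
by rewrite (same_order_nth (i := 3) (j := 1) so) // (same_order_nth (i := 1) (j := 0) so).
Qed.

Lemma subseq_rcons2 (T : eqType) (s w : seq T) x y :
  subseq (rcons s y) (rcons w x) =
    if y == x then subseq s w else subseq (rcons s y) w.
Proof. by rewrite -subseq_rev !rev_rcons /=; case: ifP; rewrite -?rev_rcons subseq_rev. Qed.

Lemma subseq_map_inv (T U : eqType) (f : T -> U) s w :
  subseq s (map f w) -> exists2 s', s = map f s' & subseq s' w.
Proof.
move=> /subseqP[m sm ->]; exists (mask m w); first by rewrite map_mask.
exact: mask_subseq.
Qed.

Lemma subseq_pair (T : eqType) (w : seq T) x y : x \in w -> y \in w -> x != y ->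
  subseq [:: x; y] w \/ subseq [:: y; x] w.
Proof.
move=> xw; case/splitPr: xw => a b; rewrite mem_cat inE.
case/or3P => [ya|/eqP->|yb] xy; last 1 first.
- left; apply: (@cat_subseq _ [::] _ _ _ (sub0seq a)).
  by rewrite /= eqxx sub1seq.
- right; apply: (@cat_subseq _ [:: y] [:: x]); first by rewrite sub1seq.
  by rewrite sub1seq mem_head.
by rewrite eqxx in xy.
Qed.

(** A new occurrence of a pattern must end in the new letter. It needs two larger letters, which
    excludes the two top values. For [v] equal to the last letter of [w], that old letter could
    replace the new one, giving an occurrence already in [w]. *)
Lemma avoids_insert_last v w : std w -> w != [::] -> 0 < v <= (size w).+1 ->
  avoids231 (insert_last v w) /\ avoids4312 (insert_last v w) <->
  [/\ avoids231 w, avoids4312 w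
    & [|| v == last 0 w, v == size w | v == (size w).+1]].
Proof.
move=> sw w0 v_n; have uw : uniq w by case/andP: sw.
have le_n x : x \in w -> x <= size w by rewrite mem_std // => /andP[].
have [w' [l Ew]] : exists w' l, w = rcons w' l.
  by case/lastP: w w0 {sw v_n uw le_n} => // w' l _; exists w', l.
have last_w : last 0 w = l by rewrite Ew last_rcons.
have lw : l \in w by rewrite Ew mem_rcons mem_head.
have lw' : l \notin w' by move: uw; rewrite Ew rcons_uniq => /andP[].
have sub2 x y : subseq [:: x; y] w -> y != l -> subseq [:: x; y; l] w.
  by rewrite Ew => + /negbTE yl; rewrite (subseq_rcons2 [:: x]) yl
    (subseq_rcons2 [:: x; y]) eqxx.
have sub3 x y z : subseq [:: x; y; z] w -> z != l -> subseq [:: x; y; z; l] w.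
  by rewrite Ew => + /negbTE zl; rewrite (subseq_rcons2 [:: x; y]) zl
    (subseq_rcons2 [:: x; y; z]) eqxx.
have last_unique x y : subseq [:: x; y] w -> x != l.
  move=> xy; apply: contraNneq lw' => <-; move: xy; rewrite Ew.
  rewrite (subseq_rcons2 [:: x]); case: ifP => _; first by rewrite sub1seq.
  by move=> /mem_subseq; apply; rewrite mem_head.
have last_unique2 x y z : subseq [:: x; y; z] w -> y != l.
  by move=> xyz; apply: (last_unique y z); apply: subseq_trans xyz; apply: subseq_cons.
split=> [[a1 a2]|[a1 a2 vl]].
  have sub_ins s : subseq s w -> subseq (map (bump v) s) (insert_last v w).
    by move=> sw'; apply: subseq_trans (subseq_rcons _ _); apply: map_subseq.
  have b1 : avoids231 w.
    by move=> a b c /sub_ins /a1; rewrite !ltn_bump2.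
  split=> //.
    by move=> a b c d /sub_ins /a2; rewrite !ltn_bump2.
  apply/negP => /negP; rewrite !negb_or last_w => /and3P[vl vn vn1].
  have vw : v \in w by rewrite mem_std //; lia.
  (* The old letter [v] becomes [v.+1]. If [v < l], it forms 231 with [l] and the new [v]. If
     [l < v], it forms 231 with the maximum when it precedes it; otherwise the maximum, the old [v],
     [l] and the new [v] form 4312. *)
  have [ltvl|ltlv|/eqP] := ltngtP v l; last by rewrite (negbTE vl).
    have [vl_w|/last_unique] := subseq_pair vw lw vl; last by rewrite eqxx.
    have /a1 : subseq [:: bump v v; bump v l; v] (insert_last v w).
      by rewrite (subseq_rcons2 [:: bump v v; bump v l]) eqxx; apply: map_subseq vl_w.
    by rewrite /bump; lia.
  have nw : size w \in w by rewrite mem_std // leqnn; move: (le_n l lw); lia.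
  have [vn_w|/sub2 nvl] := subseq_pair vw nw vn.
    have /a1 : subseq [:: bump v v; bump v (size w); v] (insert_last v w).
      by rewrite (subseq_rcons2 [:: bump v v; bump v (size w)]) eqxx; apply: map_subseq vn_w.
    by rewrite /bump; lia.
  have /a2 : subseq [:: bump v (size w); bump v v; bump v l; v] (insert_last v w).
    rewrite (subseq_rcons2 [:: bump v (size w); bump v v; bump v l]) eqxx.
    by apply: (map_subseq (bump v)) (nvl vl).
  by rewrite /bump; lia.
split=> [a b c|a b c d].
  rewrite (subseq_rcons2 [:: a; b]); case: eqP => [->|_]; last first.
    by case/subseq_map_inv => -[|? [|? [|? []]]] // [-> -> ->] /a1; rewrite !ltn_bump2.
  case/subseq_map_inv => -[|x [|y []]] // [-> ->] xy; rewrite ltn_bump2.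
  have yw : y \in w by apply: (mem_subseq xy); rewrite !inE eqxx orbT.
  have := le_n y yw; move: vl; rewrite last_w => /or3P[/eqP vl|/eqP vn|/eqP vn]; last 2 first.
  - by rewrite /bump; lia.
  - by rewrite /bump; lia.
  have [yl|yl] := eqVneq y l; first by rewrite /bump; lia.
  by have := a1 _ _ _ (sub2 _ _ xy yl); have := last_unique _ _ xy; rewrite /bump; lia.
rewrite (subseq_rcons2 [:: a; b; c]); case: eqP => [->|_]; last first.
  by case/subseq_map_inv => -[|? [|? [|? [|? []]]]] // [-> -> -> ->] /a2; rewrite !ltn_bump2.
case/subseq_map_inv => -[|x [|y [|z []]]] // [-> -> ->] xyz; rewrite ltn_bump2.
have xw : x \in w by apply: (mem_subseq xyz); rewrite !inE eqxx.
have := le_n x xw; move: vl; rewrite last_w => /or3P[/eqP vl|/eqP vn|/eqP vn]; last 2 first.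
- by rewrite /bump; lia.
- by rewrite /bump; lia.
have [zl|zl] := eqVneq z l; first by rewrite /bump; lia.
by have := a2 _ _ _ _ (sub3 _ _ _ xyz zl); have := last_unique2 _ _ _ xyz; rewrite /bump; lia.
Qed.

(** * Coding by runs of the stack machine *)

Inductive letter := Fall | Peak | Rise.

Definition letter_code (a : letter) : option bool :=
  match a with Fall => None | Peak => Some true | Rise => Some false end.

Definition letter_decode (a : option bool) : letter :=
  match a with None => Fall | Some true => Peak | Some false => Rise end.

Lemma letter_codeK : cancel letter_code letter_decode.
Proof. by case. Qed.

HB.instance Definition _ := Equality.copy letter (can_type letter_codeK).

Definition letter_value (w : seq nat) (a : letter) : nat :=
  match a with Fall => last 0 w | Peak => (size w).+1 | Rise => size w end.

Definition append (w : seq nat) (a : letter) := insert_last (letter_value w a) w.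

Definition build (c : seq letter) : seq nat := foldl append [:: 1] c.

Lemma build_rcons c a : build (rcons c a) = append (build c) a.
Proof. by rewrite /build -cats1 foldl_cat. Qed.

Lemma size_build c : size (build c) = (size c).+1.
Proof.
elim/last_ind: c => // c a IHc.
by rewrite build_rcons size_insert_last IHc size_rcons.
Qed.

(* A state [(h, t)] records a parsing stack of [h.+1] letters in which the
   largest letter read so far sits below [t] others. *)
Definition next (s : nat * nat) (a : letter) : option (nat * nat) :=
  match a with
  | Fall => Some (s.1.+1, s.2.+1)
  | Peak => if 0 < s.1 then Some (s.1.-1, 0) else None
  | Rise => if 1 < s.2 then Some (s.1.-1, s.2.-1) else None
  end.

Fixpoint run (s : nat * nat) (c : seq letter) : option (nat * nat) :=
  if c is a :: c' then obind (run^~ c') (next s a) else Some s.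

Lemma run_rcons s c a : run s (rcons c a) = obind (next^~ a) (run s c).
Proof.
elim: c s => /= [|b c IHc] s; first by case: next.
by case: (next s b) => //= s'.
Qed.

(** As [index] returns the length of the stack for an absent letter, the membership of [size w] in
    the stack is recorded too. *)
Record reaches (w : seq nat) (s : nat * nat) : Prop := Reaches {
  reaches_std : std w;
  reaches_neq0 : w != [::];
  reaches_av : avoids231 w /\ avoids4312 w;
  reaches_stack : exists2 S, parse [::] w = Some S &
    [/\ size S = s.1.+1, head 0 S = last 0 w, index (size w) S = s.2,
        size w \in S & all (leq^~ (size w)) S] }.

Lemma parse_insert_last v w S : parse [::] w = Some S ->
  parse [::] (insert_last v w) = parse_step (map (bump v) S) v.
Proof.
move=> pw; have := parse_map [::] w (ltn_bump2 v).
by rewrite /insert_last parse_rcons pw /= => ->.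
Qed.

Lemma letter_value_bound w a : std w -> w != [::] ->
  0 < letter_value w a <= (size w).+1.
Proof.
move=> sw w0; have := last_mem 0 w0; rewrite mem_std //.
by rewrite -size_eq0 -lt0n in w0; case: a => /=; lia.
Qed.

Lemma bump_size (w : seq nat) v : v <= size w -> bump v (size w) = (size w).+1.
Proof. by rewrite /bump => ->. Qed.

(** [Fall] lands just below the bumped top, hence is pushed. [Peak] exceeds everything and pops if
    there is a second letter. [Rise] is below the maximum only, so it is blocked when the maximum is
    second in the stack. If the maximum is on top, [Rise] has the same value as [Fall]: the machine
    would push while [next] refuses, so this case is excluded. *)
Lemma parse_step_next w S s a : reaches w s -> parse [::] w = Some S ->
  ~~ ((a == Rise) && (last 0 w == size w)) ->
  match next s a, parse_step (map (bump (letter_value w a)) S) (letter_value w a) with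
  | Some s', Some S' =>
      [/\ size S' = s'.1.+1, head 0 S' = letter_value w a,
          index (size w).+1 S' = s'.2, (size w).+1 \in S' &
          all (leq^~ (size w).+1) S']
  | None, None => True
  | _, _ => False
  end.
Proof.
case=> sw w0 _ [S0 -> [sS hS iS nS leS]] [E]; subst S0.
have leSb v : all (leq^~ (size w).+1) (map (bump v) S).
  by rewrite all_map; apply: sub_all leS => x /=; rewrite /bump; lia.
have idx v T : v <= size w ->
    index (size w).+1 (map (bump v) T) = index (size w) T.
  by move=> vn; rewrite -(bump_size vn) index_map //; apply: bump_inj.
have memb v T : v <= size w ->
    ((size w).+1 \in map (bump v) T) = (size w \in T).
  by move=> vn; rewrite -(bump_size vn) mem_map //; apply: bump_inj.
have lw : last 0 w <= size w.
  by have := last_mem 0 w0; rewrite mem_std // => /andP[].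
case: s sS iS => h t /= sS iS; case: S sS hS iS nS leS leSb => // l S [sS] /= lE.
rewrite -lE => iS nS /andP[ln leS] leSb Rl.
have bl v : (v < bump v l) = (v <= l) by rewrite /bump; lia.
case: a Rl => /= Rl.
- rewrite -lE bl leqnn; split=> //=; first by rewrite size_map sS.
  + have -> : l == (size w).+1 = false by lia.
    by have := idx l (l :: S) ln; rewrite /= iS => ->.
  + by rewrite inE orbC; have := memb l (l :: S) ln => /= ->; rewrite nS.
  + by apply/andP; split; [apply: leqW|apply: (leSb l)].
- have -> : (size w).+1 < bump (size w).+1 l = false by rewrite bl; lia.
  case: S sS iS nS leS leSb => [|p S] sS iS nS /= leS leSb; first by rewrite -sS.
  rewrite -sS /=; move: leS => /andP[pn leS].
  have -> : bump (size w).+1 p < (size w).+1 by rewrite /bump; lia.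
  split=> //=; rewrite ?size_map ?eqxx ?mem_head ?leqnn //=.
  by have /and3P[] := leSb (size w).+1.
have {Rl} ln' : l < size w.
  by move: Rl; rewrite ltn_neqAle ln andbT.
have -> : size w < bump (size w) l = false by rewrite bl; lia.
rewrite (ltn_eqF ln') in iS; rewrite inE (gtn_eqF ln') /= in nS.
case: S sS iS nS leS leSb => // p S /= sS iS nS /andP[pn leS] leSb.
have bp : (bump (size w) p < size w) = (p != size w).
  by rewrite /bump; lia.
rewrite bp -iS; case: eqVneq => [E|pE] //=.
have wS : size w \in S by move: nS; rewrite inE eq_sym (negbTE pE).
split=> //=.
- by rewrite size_map -sS.
- by have := idx (size w) S (leqnn _) => ->; rewrite ltn_eqF.
- by rewrite inE (memb _ _ (leqnn _)) wS orbT.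
- by rewrite leqnSn /=; have /and3P[] := leSb (size w).
Qed.

Lemma reaches_append w s a s' : reaches w s -> next s a = Some s' ->
  reaches (append w a) s'.
Proof.
move=> rws Es; have [sw w0 [a1 a2] [S pS [sS hS iS nS leS]]] := rws.
have vn := letter_value_bound a sw w0.
have notR : ~~ ((a == Rise) && (last 0 w == size w)).
  apply/negP => /andP[/eqP Ea /eqP lw]; move: Es iS; rewrite Ea /= -lw -hS.
  by case: (S) sS => //= l S0 _; rewrite eqxx => + t0; rewrite -t0.
have := parse_step_next rws pS notR.
rewrite Es; case E: parse_step => [S'|] // [sS' hS' iS' nS' leS'].
split.
- exact: std_insert_last.
- by rewrite -size_eq0 size_insert_last.
- apply/avoids_insert_last => //; split=> //.
  by case: (a); rewrite /= eqxx ?orbT.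
exists S'; first by rewrite (parse_insert_last _ pS).
by rewrite size_insert_last last_rcons.
Qed.

(** When [Fall] and [Rise] give the same value, [Fall] is chosen, as [parse_step_next] demands. *)
Lemma append_letter u : std u -> u != [::] -> avoids231 u -> avoids4312 u ->
    size u != 1 -> parse [::] u != None ->
  exists w a, [/\ std w, w != [::], avoids231 w, avoids4312 w &
     [/\ u = append w a, parse [::] w != None &
        ~~ ((a == Rise) && (last 0 w == size w))]].
Proof.
move=> su u0 a1 a2 u1; have [w [v [sw vn Eu]]] := std_insert_lastP su u0.
subst u; rewrite size_insert_last in u1.
have w0 : w != [::] by rewrite -size_eq0.
have [b1 b2 vE] := (avoids_insert_last sw w0 vn).1 (conj a1 a2).
move=> pu; have pw : parse [::] w != None.
  apply: contraNneq pu => pw; rewrite parse_rcons.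
  by have := parse_map [::] w (ltn_bump2 v); rewrite pw /= => ->.
have [vl|vl] := eqVneq v (last 0 w); first by exists w, Fall; rewrite /append /= -vl.
have [vn1|vn1] := eqVneq v (size w).+1; first by exists w, Peak; rewrite /append /= -vn1.
move: vE; rewrite (negbTE vl) (negbTE vn1) orbF /= => /eqP vS.
exists w, Rise; rewrite /append /= -vS; split=> //; split=> //.
by rewrite eq_sym.
Qed.

Lemma reaches1 : reaches [:: 1] (0, 0).
Proof.
split=> //; last by exists [:: 1].
by split=> [a b c|a b c d] /size_subseq.
Qed.

Lemma build_reaches c s : run (0, 0) c = Some s -> reaches (build c) s.
Proof.
elim/last_ind: c s => [|c a IHc] s; first by move=> [<-]; apply: reaches1.
rewrite run_rcons build_rcons; case E: run => [s0|] //= Es.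
exact: reaches_append (IHc _ E) Es.
Qed.

Lemma reaches_build u : std u -> u != [::] -> avoids231 u -> avoids4312 u ->
    parse [::] u != None ->
  exists c s, build c = u /\ run (0, 0) c = Some s.
Proof.
have [n] := ubnP (size u); elim: n u => // n IHn u un su u0 a1 a2 pu.
have [u1|u1] := eqVneq (size u) 1.
  exists [::], (0, 0); split=> //.
  by move: su; rewrite std_perm u1 => p1; rewrite (perm_small_eq _ p1).
have [w [a [sw w0 b1 b2 [Eu pw notR]]]] := append_letter su u0 a1 a2 u1 pu.
have [|c [s [Ew rc]]] := IHn w _ sw w0 b1 b2 pw.
  by move: un; rewrite Eu size_insert_last.
have rws := build_reaches rc; rewrite Ew in rws.
have [_ _ _ [S pS _]] := rws.
have := parse_step_next rws pS notR; rewrite -(parse_insert_last _ pS).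
move: pu; rewrite Eu; case: parse => // S' _.
case Es: next => [s'|] // _; exists (rcons c a), s'.
by rewrite build_rcons Ew run_rcons rc.
Qed.

Lemma insert_last_inj v v' w w' :
  insert_last v w = insert_last v' w' -> v = v' /\ w = w'.
Proof. by move=> /rcons_inj[+ vE]; rewrite vE => /(inj_map (@bump_inj v')). Qed.

(** Only [Fall] and [Rise] can share a value, namely when the last letter is the maximum, and there
    [next] refuses [Rise]. *)
Lemma letter_value_inj w a b s : reaches w s ->
    next s a -> next s b -> letter_value w a = letter_value w b -> a = b.
Proof.
case=> sw w0 _ [S _ [_ hS iS nS _]].
have := last_mem 0 w0; rewrite mem_std // => /andP[_ lw].
have noR : next s Rise -> last 0 w != size w.
  rewrite /= -hS -iS; case: (S) nS => // l T _ /=.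
  by case: eqVneq.
by case: a; case: b => //= na nb E; first [have := noR na | have := noR nb | idtac];
  lia.
Qed.

Lemma build_inj c d s s' : run (0, 0) c = Some s -> run (0, 0) d = Some s' ->
  build c = build d -> c = d.
Proof.
elim/last_ind: c d s s' => [|c a IHc] d s s' rc rd E.
  by move: (congr1 size E); rewrite !size_build; case: (d).
case/lastP: d rd E => [_ /(congr1 size)|d b].
  by rewrite !size_build size_rcons.
move: rc; rewrite !run_rcons !build_rcons.
case rc: run => [s1|] //= nc; case rd: run => [s2|] //= nd.
move=> /insert_last_inj[vE wE]; have Ecd := IHc d _ _ rc rd wE; subst d.
move: rd nd; rewrite rc => -[<-] nd; congr rcons.
by apply: (letter_value_inj (build_reaches rc)); rewrite ?nc ?nd.
Qed.

(** * Enumeration of the runs ending at height 0 *)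

Fixpoint codes (n : nat) (s : nat * nat) : seq (seq letter) :=
  if n is n'.+1 then
    flatten [seq if next s a is Some s' then map (cons a) (codes n' s') else [::]
            | a <- [:: Fall; Peak; Rise]]
  else if s.1 == 0 then [:: [::]] else [::].

Lemma mem_codes n s c :
  (c \in codes n s) = (size c == n) && (omap fst (run s c) == Some 0).
Proof.
elim: n s c => [|n IHn] s c.
  by rewrite /=; case: c => [|a c] /=; case: ifP => //= ->.
have mem_cons a b (l : seq (seq letter)) d :
    (a :: d \in map (cons b) l) = (a == b) && (d \in l).
  by apply/mapP/andP => [[e el [-> ->]]|[/eqP-> dl]]; [|exists d].
have nil_cons b (l : seq (seq letter)) : ([::] \in map (cons b) l) = false.
  by apply/mapP => -[].
case: c => [|a c].
  rewrite /= !mem_cat; case: ifP => _; case: ifP => _; rewrite ?nil_cons //.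
rewrite [codes _ _]/= !mem_cat in_nil orbF [size _]/= eqSS.
case: s => h t /=; case: a => /=; do 2 case: ifP => _ //=;
  by rewrite ?mem_cons ?in_nil ?IHn /= ?orbF ?andbF.
Qed.

Lemma codes_uniq n s : uniq (codes n s).
Proof.
elim: n s => [|n IHn] s; first by rewrite /=; case: ifP.
have um a s' : uniq (map (cons a) (codes n s')).
  by rewrite map_inj_uniq // => c d [].
have dis a b l l' : a != b -> ~~ has (mem (map (cons a) l)) (map (cons b) l').
  move=> ab; apply/hasPn => _ /mapP[c _ ->]; apply/mapP => -[d _ [E _]].
  by rewrite E eqxx in ab.
rewrite /= cats0 !cat_uniq has_cat negb_or um /=.
by do 2 case: ifP => _; rewrite /= ?um ?dis ?has_pred0 ?andbT //=; apply/hasPn.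
Qed.

(** [build] is the bijection: final height 0 means a stack of one letter, that is, a tight word. *)
Lemma card_uniquely_sorted_avoiding n :
  #|uniquely_sorted_avoiding n.+1 [:: [:: 2; 3; 1]; [:: 4; 3; 1; 2]]| =
  size (codes n (0, 0)).
Proof.
set A := uniquely_sorted_avoiding _ _.
rewrite cardE -(size_map (@one_line n.+1)) -(size_map build).
apply/perm_size/uniq_perm.
- by rewrite (map_inj_uniq (@one_line_inj _)) enum_uniq.
- rewrite map_inj_in_uniq ?codes_uniq // => c d.
  rewrite !mem_codes => /andP[_ rc] /andP[_ rd].
  case Ec: run rc => [s|] // _; case Ed: run rd => [s'|] // _.
  exact: build_inj Ec Ed.
move=> w; apply/mapP/mapP => [[p pA ->]|[c]].
  move: pA; rewrite mem_enum inE /= andbT => /and3P[/uniquely_sortedP tp].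
  move=> /avoids231P a1 /avoids4312P a2.
  have sp : size (one_line p) = n.+1.
    by rewrite (perm_size (perm_one_line p)) size_iota.
  have std_p : std (one_line p) by rewrite std_perm sp perm_one_line.
  have p0 : one_line p != [::] by rewrite -size_eq0 sp.
  have up : uniq (one_line p) by case/andP: std_p.
  have [S pS S1] := (tightP up).1 (tp isT).
  have [|c [s [bc rc]]] := reaches_build std_p p0 a1 a2; first by rewrite pS.
  exists c; rewrite // mem_codes rc.
  have [_ _ _ [S']] := build_reaches rc; rewrite bc pS => -[<-] [+ _ _ _ _].
  move: sp; rewrite S1 -bc size_build => -[->] [s0].
  by rewrite /= -s0 !eqxx.
rewrite mem_codes => /andP[/eqP cn]; case rc: run => [s|] //= /eqP[s0] ->.
have [sc c0 [a1 a2] [S pS [S1 _ _ _ _]]] := build_reaches rc.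
rewrite s0 in S1; have uc : uniq (build c) by case/andP: sc.
have [|p Ep] := @one_line_onto n.+1 (build c).
  by rewrite -cn -size_build -std_perm.
exists p; rewrite ?Ep // mem_enum inE /= andbT; apply/and3P; split.
- by apply/uniquely_sortedP => //; rewrite Ep; apply/tightP => //; exists S.
- by apply/avoids231P; rewrite Ep.
- by apply/avoids4312P; rewrite Ep.
Qed.

(** * Generating functions *)

Lemma size_codesS n h t : size (codes n.+1 (h, t)) =
  size (codes n (h.+1, t.+1)) + (if 0 < h then size (codes n (h.-1, 0)) else 0)
    + (if 1 < t then size (codes n (h.-1, t.-1)) else 0).
Proof.
rewrite /= !size_cat size_map addn0 addnA.
by do 2 case: ifP => _; rewrite /= ?size_map.
Qed.

(** Each letter lowers the height by at most one. *)
Lemma codes_lt n h t : n < h -> codes n (h, t) = [::].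
Proof.
move=> lt_nh; apply/nilP; rewrite /nilp; apply/eqP.
elim: n h t lt_nh => [|n IHn] h t lt_nh; first by case: h lt_nh.
rewrite size_codesS !IHn; do ?[by lia].
by do 2 case: ifP.
Qed.

Local Open Scope ring_scope.

(* The generating function of the runs from state [(h, t)] to height 0, up to
   the power of [x] forced by [h]: [c] counts the excursions that keep the
   current maximum, [g] all excursions. *)
Definition state_gf (R : comNzRingType) (c g : R) (h t : nat) : R :=
  if t is 0%N then g ^+ h.+1
  else \sum_(i < t) c ^+ i.+1 * g ^+ (h.+1 - i).

(** The terms on the right correspond to a first letter [Peak] (or the empty run), [Rise] and
    [Fall], with [x] marking [Fall]. In [state_gf], [i] is the largest drop below height [h] before
    the first [Peak]; climbing [j] levels from there contributes [c^(i+1) (x c)^j g^(h-i+j)], and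
    summing over [j] yields a factor [g] since [g (1 - x c g) = 1]. *)
Lemma state_gf_rec (R : comNzRingType) (x c g : R) h t :
    c = 1 + x * c ^+ 2 -> g = 1 + x * c * g ^+ 2 -> (t <= h)%N ->
  state_gf c g h t =
    (if h is h'.+1 then state_gf c g h' 0 else 1)
    + (if (1 < t)%N then state_gf c g h.-1 t.-1 else 0)
    + x * state_gf c g h.+1 t.+1.
Proof.
move=> cE gE; have gS n : g ^+ n.+1 = g ^+ n + x * (c * g ^+ n.+2).
  by rewrite exprS {1}gE !exprS; ring.
case: t => [_|t lt_th].
  rewrite /= big_ord1 subn0 addr0 expr1 gS.
  by case: h => [|h] //=; rewrite expr0.
case: h lt_th => // h lt_th.
have -> : (if (1 < t.+1)%N then state_gf c g h.+1.-1 t.+1.-1 else 0)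
    = \sum_(i < t) c ^+ i.+1 * g ^+ (h.+1 - i).
  by case: t lt_th => //= _; rewrite big_ord0.
rewrite /=; elim: t lt_th => [|t IHt] lt_th.
  rewrite big_ord0 addr0 big_ord1 big_ord_recr big_ord1 /= !subn0 subSS subn0.
  rewrite mulrDr addrA expr1 -gS [in LHS]cE; ring.
rewrite big_ord_recr IHt 1?ltnW // [in RHS]big_ord_recr [in RHS]big_ord_recr /=.
have -> : (h.+2 - t.+1 = h.+1 - t)%N by [].
have -> : (h.+3 - t.+2 = h.+1 - t)%N by [].
(* Only the new top summand is expanded; its two parts are the new summands of the [Rise] and [Fall]
   terms. *)
have -> : c ^+ t.+2 = c ^+ t.+1 + x * c ^+ t.+3.
  by rewrite exprS {1}cE !exprS; ring.
by rewrite mulrDr; ring.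
Qed.

(** * Truncated power series, in which the variable is nilpotent *)

Local Notation truncated m := {poly %/ ('X^(m.+1) : {poly rat})}.

Definition tr (m : nat) (p : {poly rat}) : truncated m :=
  in_qpoly 'X^(m.+1) p.

Lemma trE m p : tr m p = take_poly m.+1 p :> {poly rat}.
Proof.
rewrite /tr /= mk_monic_Xn /= Pdiv.IdomainMonic.take_poly_modp.
by rewrite Pdiv.IdomainMonic.modpE ?monicXn.
Qed.

Lemma coef_tr m p k : (k <= m)%N -> (tr m p : {poly rat})`_k = p`_k.
Proof. by move=> km; rewrite trE coef_take_poly ltnS km. Qed.

Lemma trK m (u : truncated m) : tr m u = u.
Proof.
apply: val_inj; rewrite [val _]trE; apply: take_poly_id.
apply: leq_trans (_ : (size (mk_monic ('X^(m.+1) : {poly rat}))).-1 <= _)%N.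
  exact: size_npoly.
by rewrite mk_monic_Xn size_polyXn.
Qed.

Lemma coef_trXM m (u : truncated m) k : (k <= m)%N ->
  (tr m 'X * u : {poly rat})`_k = if k is k'.+1 then (u : {poly rat})`_k' else 0.
Proof.
move=> km; rewrite -{1}[u]trK -[_ * _]/(in_qpoly _ _ * in_qpoly _ _).
by rewrite -in_qpolyM coef_tr // coefXM; case: k km.
Qed.

Lemma trX_nilpotent m : tr m 'X ^+ m.+1 = 0.
Proof.
rewrite /tr -rmorphXn; apply: val_inj; rewrite [val _]trE.
by apply/polyP => i; rewrite coef_take_poly coefXn coef0; case: ltngtP.
Qed.

(** A run from height [h] to 0 with [k] letters [Fall] has [k + h] pops, hence length [2 k + h]; the
    induction on this length follows the first letter. *)
Lemma coef_state_gf m (c g : truncated m) n h t k :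
    c = 1 + tr m 'X * c ^+ 2 -> g = 1 + tr m 'X * c * g ^+ 2 ->
    (t <= h)%N -> (k <= m)%N -> n = (2 * k + h)%N ->
  (state_gf c g h t : {poly rat})`_k = (size (codes n (h, t)))%:R.
Proof.
move=> cE gE; have one_k j : ((1 : truncated m) : {poly rat})`_j = (j == 0)%:R.
  rewrite -[1](in_qpoly1 'X^(m.+1)) -[in_qpoly _ _]/(tr m 1) trE.
  by rewrite coef_take_poly coef1; case: j => // j; rewrite if_same.
elim: n h t k => [|n IHn] h t k th km nE.
  have [-> h0] : k = 0%N /\ h = 0%N by lia.
  have t0 : t = 0%N by lia.
  rewrite h0 t0 /= expr1 gE -mulrA poly_of_qpolyD coefD coef_trXM //.
  by rewrite one_k addr0.
rewrite (state_gf_rec cE gE th) size_codesS !poly_of_qpolyD !coefD !natrD.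
rewrite coef_trXM // addrC -addrA; congr (_ + (_ + _)).
(* For [k = 0] a first [Fall] leaves too few letters to come back to height 0. *)
- case: k km nE => [|k] km nE; first by rewrite codes_lt //; lia.
  by apply: IHn; lia.
- case: h th nE => [|h] th nE; last by apply: (IHn h 0%N); lia.
  by rewrite one_k; case: k km nE.
case: ltnP => t1; last by rewrite coef0.
by apply: IHn; lia.
Qed.

(* The value [f(y)] of a series at a nilpotent [y], by truncation. *)
Definition series_at (A : comAlgType rat) (m : nat) (y : A) (f : fps) : A :=
  horner_alg y (\poly_(i < m.+1) f i).

Lemma series_atE (A : comAlgType rat) m (y : A) f :
  series_at m y f = \sum_(i < m.+1) f i *: y ^+ i.
Proof.
rewrite /series_at poly_def linear_sum; apply: eq_bigr => i _.
by rewrite linearZ rmorphXn /= horner_algX mulr_algl.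
Qed.

(** The terms of [p] of degree above [m] vanish at [y], so any polynomial agreeing with [f] up to
    degree [m] computes the value. *)
Lemma series_at_horner (A : comAlgType rat) m (y : A) (f : fps) (p : {poly rat}) :
    y ^+ m.+1 = 0 -> (forall i, (i <= m)%N -> f i = p`_i) ->
  series_at m y f = horner_alg y p.
Proof.
move=> ym fp; rewrite /series_at -[in RHS](poly_take_drop m.+1 p).
rewrite rmorphD rmorphM rmorphXn /= horner_algX ym mulr0 addr0.
congr (horner_alg y _); apply/polyP => i.
by rewrite coef_poly coef_take_poly; case: ltnP => // im; apply: fp.
Qed.

Lemma series_atM (A : comAlgType rat) m (y : A) f g : y ^+ m.+1 = 0 ->
  series_at m y (fps_mul f g) = series_at m y f * series_at m y g.
Proof.
move=> ym; rewrite (series_at_horner (p := (\poly_(i < m.+1) f i) * \poly_(i < m.+1) g i)) //.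
  by rewrite rmorphM.
move=> i im; rewrite coefM; apply: eq_bigr => j _.
by rewrite !coef_poly !ltnS (leq_trans (leq_ord j) im) (leq_trans (leq_subr _ _) im).
Qed.

Lemma series_at1 (A : comAlgType rat) m (y : A) : y ^+ m.+1 = 0 ->
  series_at m y fps_one = 1.
Proof.
move=> ym; rewrite (series_at_horner (p := 1)) ?rmorph1 // => i _.
by rewrite coef1.
Qed.

Lemma series_atX (A : comAlgType rat) m (y : A) : y ^+ m.+1 = 0 ->
  series_at m y fps_X = y.
Proof.
move=> ym; rewrite (series_at_horner (p := 'X)) /= ?horner_algX // => i _.
by rewrite coefX.
Qed.

Lemma series_at_exp (A : comAlgType rat) m (y : A) f k : y ^+ m.+1 = 0 ->
  series_at m y (fps_exp f k) = series_at m y f ^+ k.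
Proof.
move=> ym; elim: k => [|k IHk]; first exact: series_at1.
by rewrite [fps_exp _ _]/= series_atM // IHk exprS.
Qed.

(** Coefficient [n.+2] of the square of [sqrt_1m4x] is 0: its two end terms give [- 4 C_(n+1)] and
    the inner ones four times the convolution. *)
Lemma catalan_conv n :
  fps_mul catalan_series catalan_series n = catalan_series n.+1.
Proof.
have /eqP := sqrt_1m4xP n.+2; rewrite /fps_mul.
have sS i : sqrt_1m4x i.+1 = - 2 * catalan_series i.
  by rewrite /sqrt_1m4x fps_mulX /fps_one /=; ring.
rewrite big_ord_recl big_ord_recr /= subn0 subnn sqrt_1m4x0 !sS /fps_one /fps_X /=.
rewrite (eq_bigr (fun i : 'I_n.+1 => 4 * (catalan_series i * catalan_series (n - i)%N))).
  by rewrite -mulr_sumr => /eqP E; lra.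
by move=> i _; rewrite /= /bump /= add1n subSS subSn ?leq_ord // !sS; ring.
Qed.

Lemma series_at_catalan (A : comAlgType rat) m (y : A) : y ^+ m.+1 = 0 ->
  series_at m y catalan_series = 1 + y * series_at m y catalan_series ^+ 2.
Proof.
move=> ym; rewrite -[in RHS](series_at1 ym) expr2 -series_atM //.
rewrite -[X in _ + X * _](series_atX ym) -series_atM //.
rewrite !series_atE -big_split /=; apply: eq_bigr => i _.
rewrite -scalerDl fps_mulX /fps_one; congr (_ *: _).
case: (nat_of_ord i) => [|k] /=; last by rewrite catalan_conv add0r.
by rewrite addr0 /catalan_series /= bin0 divr1.
Qed.

Lemma coef_series_at_trX m f k : (k <= m)%N ->
  (series_at m (tr m 'X) f : {poly rat})`_k = f k.
Proof.
move=> km; have -> : series_at m (tr m 'X) f = tr m (\poly_(i < m.+1) f i).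
  rewrite series_atE /tr poly_def linear_sum; apply: eq_bigr => i _.
  by rewrite linearZ rmorphXn.
by rewrite coef_tr // coef_poly ltnS km.
Qed.

Theorem theorem7p1 :
  (fun k : nat =>
     #|uniquely_sorted_avoiding (2 * k + 1)
         [:: [:: 2; 3; 1]%N; [:: 4; 3; 1; 2]%N]|%:R : rat)
  =1 fps_comp catalan_series (fps_mul fps_X catalan_series).
Proof.
move=> m; rewrite addn1 card_uniquely_sorted_avoiding.
set x := tr m 'X; have xm : x ^+ m.+1 = 0 := trX_nilpotent m.
pose c := series_at m x catalan_series.
have xcm : (x * c) ^+ m.+1 = 0 by rewrite exprMn xm mul0r.
(* The Catalan equation at [x * c] is exactly the equation that [coef_state_gf] requires of [g]. *)
pose g := series_at m (x * c) catalan_series.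
rewrite -(@coef_state_gf m c g (2 * m)%N 0 0 m) ?addn0 //; first last.
- exact: series_at_catalan.
- exact: series_at_catalan.
rewrite /= expr1 /g series_atE poly_of_qpoly_sum coef_sum.
apply: eq_bigr => k _; rewrite poly_of_qpolyZ coefZ; congr (_ * _).
(* The powers of [x * c] are the values at [x] of the powers of the inner series, so their
   coefficients can be read off. *)
by rewrite -(series_atX xm) -series_atM // -series_at_exp // coef_series_at_trX.
Qed.
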